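(* If $G$ is a twin-free acyclic digraph of order $n$, then $\gamma_L(G)\leq\lceil\frac{n}{2}\rceil$.
   Context: Digraphs are loopless without multiple arcs; acyclic means no directed cycle. Two vertices are twins if they have the same open in-neighbourhood or the same closed in-neighbourhood. A dominating set is a set $D$ such that every vertex not in $D$ has an in-neighbour in $D$; it is locating-dominating if moreover every vertex not in $D$ has a distinct set of in-neighbours in $D$. $\gamma_L(G)$ is the minimum size of a locating-dominating set. *)

(* Defs.v *)
From mathcomp Require Import all_boot.

Set Implicit Arguments.
Unset Strict Implicit.
Unset Printing Implicit Defensive.

(* Opposite arcs u -> v and v -> u may coexist. *)
Record digraph (V : finType) := Digraph {
  arc : rel V;
  arc_loopless : irreflexive arc
}.

Section Digraph.
Variables (V : finType) (G : digraph V).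
Implicit Types (u v : V) (D : {set V}).

Definition in_nbh v : {set V} := [set u | arc G u v].
Definition closed_in_nbh v : {set V} := v |: in_nbh v.

(* By looplessness such a cycle has length at least 2; opposite arcs form a
   directed cycle of length 2. *)
Definition acyclic := forall c : seq V, ucycle (arc G) c -> c = [::].

Definition twins u v :=
  (in_nbh u == in_nbh v) || (closed_in_nbh u == closed_in_nbh v).

Definition twin_free := forall u v, u != v -> ~~ twins u v.

Definition dominating D :=
  [forall v, (v \notin D) ==> [exists u in D, arc G u v]].

Definition locating_dominating D :=
  dominating D &&
  [forall u, forall v, [&& u \notin D, v \notin D & u != v] ==>
    (in_nbh u :&: D != in_nbh v :&: D)].

Lemma locating_dominatingT : locating_dominating [set: V].
Proof.
apply/andP; split; first by apply/forallP => v; rewrite inE.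
by apply/forallP => u; apply/forallP => v; rewrite inE.
Qed.

Definition gammaL : nat :=
  #|[arg min_(D < [set: V] | locating_dominating D) #|D| ]|.

Lemma gammaL_witness : exists2 D, locating_dominating D & #|D| = gammaL.
Proof.
rewrite /gammaL; case: arg_minnP => [|D ldD _]; first exact: locating_dominatingT.
by exists D.
Qed.

Lemma gammaL_min D : locating_dominating D -> gammaL <= #|D|.
Proof.
rewrite /gammaL; case: arg_minnP => [|D' _ minD']; last exact: minD'.
exact: locating_dominatingT.
Qed.

End Digraph.

(* Main.v *)
(** Rank the vertices injectively along a topological order, let [s] be the
source, and add a dummy object [None] with empty in-neighbourhood, so that
dominating means being separated from the dummy. For [B] containing [s],
let [q(B)] be the number of traces on [B] of the objects outside [B]. Call [b]
good in [B] if two objects outside [B] agree on the elements of [B] of rank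
above [b] but not at [b]. If all elements of [B] but [s] are good, then each of
them increases the number of traces when added in decreasing rank, so
[#|B| <= q(B)].
Among these sets, choose one that maximizes [q(B)], then the sum of the
[2 ^ rank b]. If two objects had the same trace, some [x] would separate them;
then [q(x |: B) >= q(B)], and [x] and the elements of [B] above [x] are good in
[x |: B] (acyclicity: [x] has no in-neighbour above it, so the dummy can replace
[x] as a witness). Discarding superfluous elements of rank below [x] keeps [q],
makes everything good, and increases the sum: a contradiction. Hence all
[n + 1 - #|B|] traces are distinct and [#|B| <= n + 1 - #|B|]. *)
Require Import Defs.
From mathcomp Require Import all_boot.

Set Implicit Arguments.
Unset Strict Implicit.
Unset Printing Implicit Defensive.

(** * Topological ranks and counting tools *)

(** The number of ancestors grows along arcs; ties are broken by [enum_rank], used as the low digit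
    in base [#|V|]. *)
Lemma acyclic_rank (V : finType) (G : digraph V) : acyclic G ->
  exists2 f : V -> nat, injective f & forall u v, Defs.arc G u v -> f u < f v.
Proof.
move=> acG; pose anc v := #|[set u | connect (Defs.arc G) u v]|.
have anc_lt u v : Defs.arc G u v -> anc u < anc v.
  move=> uv; apply/proper_card/properP; split.
    by apply/subsetP => w; rewrite !inE => /connect_trans -> //; apply: connect1.
  exists v; first by rewrite inE connect0.
  (* A path from [v] back to [u], made simple, would close up with the arc into a directed cycle. *)
  rewrite inE; apply/negP => /connectP [p vp lp].
  case: (shortenP vp) lp => p' vp' up' _ lp'.
  suff: v :: p' = [::] by [].
  by apply: acG; rewrite /ucycle /cycle rcons_path vp' -lp' uv up'.
exists (fun v => anc v * #|V| + enum_rank v) => [u v e|u v /anc_lt uv].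
  apply/enum_rank_inj/val_inj => /=.
  have := congr1 (modn^~ #|V|) e.
  by rewrite !modnMDl !modn_small.
apply: (@leq_trans ((anc u).+1 * #|V|)).
  by rewrite mulSn addnC ltn_add2r.
by apply: leq_trans (leq_addr _ _); rewrite leq_mul2r uv orbT.
Qed.

(** With these weights, gaining one element outweighs losing any set of elements of lower rank. *)
Lemma sum_exp2_lt (T : finType) (f : T -> nat) (A : {set T}) (k : nat) :
  injective f -> {in A, forall a, f a < k} -> \sum_(a in A) 2 ^ f a < 2 ^ k.
Proof.
move=> f_inj; elim: k A => [|k IH] A Ak.
  by rewrite big1 // => a /Ak.
have [a /andP[aA /eqP fa]|no] := pickP [pred a | (a \in A) && (f a == k)].
  rewrite (big_setD1 a) //= fa expnS mul2n -addnn ltn_add2l.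
  apply: IH => b; rewrite !inE => /andP[ba bA].
  have := Ak b bA; rewrite ltnS leq_eqVlt => /orP[/eqP fb|//].
  by case/eqP: ba; apply: f_inj; rewrite fa.
apply: leq_trans (_ : 2 ^ k <= _); last by rewrite leq_exp2l.
apply: IH => b bA; have := Ak b bA; rewrite ltnS leq_eqVlt => /orP[fb|//].
by have := no b; rewrite /= bA fb.
Qed.

Lemma card_imset_lt (aT rT : finType) (g : aT -> rT) (A : {set aT}) (a b : aT) :
  a \in A -> b \in A -> a != b -> g a = g b -> #|g @: A| < #|A|.
Proof.
move=> aA bA ab gab; rewrite ltn_neqAle leq_imset_card andbT.
by apply: contra ab => /imset_injP g_inj; apply/eqP/g_inj.
Qed.

(** * Traces, good elements and valid sets *)

Section Traces.
Variables (V : finType) (G : digraph V) (f : V -> nat) (s : V).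
Hypothesis f_inj : injective f.
Hypothesis f_mono : forall u v, Defs.arc G u v -> f u < f v.
Implicit Types (B C U : {set V}) (o u w : option V) (b x : V).

Definition nbh o : {set V} := if o is Some v then in_nbh G v else set0.

Definition outside B : {set option V} := ~: (Some @: B).

Lemma outsideE B v : (Some v \in outside B) = (v \notin B).
Proof. by rewrite inE mem_imset //; apply: Some_inj. Qed.

Lemma outside_None B : None \in outside B.
Proof. by rewrite inE; apply/imsetP => -[]. Qed.

Lemma outsideS B C : B \subset C -> outside C \subset outside B.
Proof. by move=> BC; rewrite setCS imsetS. Qed.

Lemma card_outside B : #|outside B| + #|B| = #|V|.+1.
Proof.
by rewrite -card_option -(cardsC (Some @: B)) addnC card_imset //; apply: Some_inj.
Qed.

Definition traces B U : {set {set V}} := [set nbh o :&: U | o in outside B].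

Lemma traces_restrict B U C : C \subset U ->
  [set X :&: C | X in traces B U] = traces B C.
Proof.
move=> CU; rewrite -imset_comp; apply: eq_imset => o /=.
by rewrite -setIA (setIidPr CU).
Qed.

Definition above B b : {set V} := [set c in B | f b < f c].

Definition good B b : bool := [exists u in outside B, exists w in outside B,
  [&& nbh u :&: above B b == nbh w :&: above B b, b \in nbh u & b \notin nbh w]].

Lemma goodP B b : reflect
  (exists u w, [/\ u \in outside B, w \in outside B,
     nbh u :&: above B b = nbh w :&: above B b, b \in nbh u & b \notin nbh w])
  (good B b).
Proof.
apply: (iffP exists_inP) => [[u uB /exists_inP[w wB /and3P[/eqP e bu bw]]]|].
  by exists u, w.
move=> [u [w [uB wB e bu bw]]]; exists u => //; apply/exists_inP; exists w => //.
by rewrite e eqxx bu.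
Qed.

Definition valid B : bool := (s \in B) && [forall b in B :\ s, good B b].

Lemma validP B : reflect
  (s \in B /\ forall b, b \in B -> b != s -> good B b) (valid B).
Proof.
apply: (iffP andP) => -[sB gB]; split=> //.
  by move=> b bB bs; apply: (forall_inP gB); rewrite !inE bs.
by apply/forall_inP => b; rewrite !inE => /andP[bs bB]; apply: gB.
Qed.

(** Induction on [C], removing its element [b] of lowest rank: the rest lies above [b], so the
    witnesses of goodness have traces on [C] that merge on [C :\ b]. Strictness comes from the
    single trace on the empty set. *)
Lemma card_lt_traces B C : C \subset B -> {in C, forall b, good B b} ->
  #|C| < #|traces B C|.
Proof.
have [k] := ubnP #|C|; elim: k C => // k IH C Ck CB gC.
have [->|[c cC]] := set_0Vmem C.
  rewrite cards0 card_gt0; apply/set0Pn.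
  by exists (nbh None :&: set0); apply/imset_f/outside_None.
case: (arg_minnP (P := fun a => a \in C) f cC) => b bC bmin.
have /goodP [u [w [uB wB e bu bw]]] := gC b bC.
have C'C : C :\ b \subset C by apply: subsetDl.
have C'a : C :\ b \subset above B b.
  apply/subsetP => a; rewrite !inE => /andP[ab aC].
  rewrite (subsetP CB) //= ltn_neqAle bmin // andbT.
  by apply: contra ab => /eqP/f_inj ->.
have lt1 : #|traces B (C :\ b)| < #|traces B C|.
  rewrite -(traces_restrict _ C'C).
  apply: (@card_imset_lt _ _ _ _ (nbh u :&: C) (nbh w :&: C)).
  - exact: imset_f.
  - exact: imset_f.
  - by apply/eqP => /setP/(_ b); rewrite !inE bu (negPf bw) bC.
  rewrite -!setIA (setIidPr C'C) -(setIidPr C'a) !setIA e.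
  by rewrite -!setIA.
apply: leq_trans lt1; rewrite (cardsD1 b C) bC add1n ltnS.
apply: IH; first by rewrite (cardsD1 b C) bC in Ck.
  exact: subset_trans C'C CB.
by move=> a /(subsetP C'C); apply: gC.
Qed.

Lemma valid_card B : valid B -> #|B| <= #|traces B B|.
Proof.
(* The strict bound for [B :\ s] pays for [s]. *)
move=> /validP [sB gB]; rewrite (cardsD1 s B) sB add1n.
apply: leq_trans (card_lt_traces (C := B :\ s) _ _) _.
- exact: subsetDl.
- by move=> b; rewrite !inE => /andP[bs bB]; apply: gB.
by rewrite -(traces_restrict B (subsetDl B [set s])) leq_imset_card.
Qed.

(** * Adding and removing elements *)

(** At most the trace of [x] itself is lost; in that case [u] and [w] both stay outside, and their
    common trace splits in two. *)
Lemma traces_add B x u w : u \in outside B -> w \in outside B ->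
  nbh u :&: B = nbh w :&: B -> x \in nbh u -> x \notin nbh w ->
  #|traces B B| <= #|traces (x |: B) (x |: B)|.
Proof.
move=> uB wB uw xu xw; set Bx := x |: B.
have outE o : o \in outside B -> o != Some x -> o \in outside Bx.
  case: o => [v|_ _]; last exact: outside_None.
  by rewrite !outsideE /Bx !inE negb_or => -> vx; rewrite andbT.
have restrict := traces_restrict Bx (subsetUr [set x] B).
have sub : traces B B \subset (nbh (Some x) :&: B) |: traces Bx B.
  apply/subsetP => _ /imsetP[o oB ->]; rewrite inE in_set1.
  have [->|ox] := eqVneq o (Some x); first by rewrite eqxx.
  by apply/orP; right; apply/imset_f/outE.
have [xT|xT] := boolP (nbh (Some x) :&: B \in traces Bx B).
  apply: leq_trans (subset_leq_card sub) _.
  by rewrite (setUidPr _) ?sub1set // -restrict leq_imset_card.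
apply: leq_trans (subset_leq_card sub) _; rewrite cardsU1 xT add1n.
(* If one of [u], [w] were [x], the other would preserve the trace of [x]. *)
have uBx : u \in outside Bx.
  apply: (outE) => //; apply: contraNneq xT => ux.
  rewrite -ux uw; apply/imset_f/outE => //.
  by apply: contraNneq xw => wx; rewrite wx -ux.
have wBx : w \in outside Bx.
  apply: (outE) => //; apply: contraNneq xT => wx.
  by rewrite -wx -uw; apply/imset_f.
rewrite -restrict.
apply: (@card_imset_lt _ _ _ _ (nbh u :&: Bx) (nbh w :&: Bx)).
- exact: imset_f.
- exact: imset_f.
- by apply/eqP => /setP/(_ x); rewrite !inE xu (negPf xw) eqxx.
by rewrite -!setIA (setIidPr (subsetUr [set x] B)).
Qed.

(** Outside objects that agree on [B :\ b] also agree at [b], so restriction merges no traces; the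
    newly outside [b] can only add one. *)
Lemma traces_remove B b : ~~ good B b ->
  #|traces B B| <= #|traces (B :\ b) (B :\ b)|.
Proof.
move=> ngb; have B'B : B :\ b \subset B by apply: subsetDl.
have agree u w : u \in outside B -> w \in outside B ->
    nbh u :&: (B :\ b) = nbh w :&: (B :\ b) -> b \in nbh u -> b \in nbh w.
  move=> uB wB e bu; apply: contraNT ngb => bw; apply/goodP; exists u, w.
  split=> //; have aB : above B b \subset B :\ b.
    apply/subsetP => c; rewrite !inE => /andP[-> lt_bc]; rewrite andbT.
    by apply: contraTneq lt_bc => ->; rewrite ltnn.
  by rewrite -(setIidPr aB) !setIA e.
apply: leq_trans (_ : #|traces B (B :\ b)| <= _); last first.
  by apply/subset_leq_card/imsetS/outsideS.
rewrite -(traces_restrict _ B'B) [leqRHS]card_in_imset //.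
move=> _ _ /imsetP[u uB ->] /imsetP[w wB ->].
rewrite -!setIA (setIidPr B'B) => e.
apply/setP => c; rewrite !inE; have [->|cb] := eqVneq c b.
  by congr (_ && _); apply/idP/idP; apply: agree.
by have /setP/(_ c) := e; rewrite !inE cb.
Qed.

(** * The exchange step and the extremal set *)

Lemma nbh_above B b x : f x <= f b -> nbh (Some x) :&: above B b = set0.
Proof.
move=> xb; apply/setP => c; rewrite !inE; apply/negP => /and3P[cx _ bc].
by have := f_mono cx; rewrite ltnNge (leq_trans xb (ltnW bc)).
Qed.

Lemma improve B x u w : valid B -> u \in outside B -> w \in outside B ->
  nbh u :&: B = nbh w :&: B -> x \in nbh u -> x \notin nbh w ->
  exists2 A, valid A & #|traces B B| <= #|traces A A| /\
    \sum_(b in B) 2 ^ f b < \sum_(b in A) 2 ^ f b.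
Proof.
move=> vB uB wB uw xu xw; have /validP [sB gB] := vB.
have xB : x \notin B.
  apply: contraNN xw => xB; have /setP/(_ x) := uw.
  by rewrite !inE xu xB /= andbT => <-.
pose T := s |: (x |: above B x).
pose P (A : {set V}) := [&& T \subset A, A \subset x |: B & #|traces B B| <= #|traces A A|].
have aBB b : above B b \subset B by apply/subsetP => c; rewrite inE => /andP[].
have PBx : P (x |: B).
  rewrite /P (traces_add uB wB uw xu xw) subxx /= andbT !subUset !sub1set.
  by rewrite !inE sB eqxx orbT /= (subset_trans (aBB x)) ?subsetUr.
case: (arg_minnP (fun A : {set V} => #|A|) PBx) => A /and3P[TA AB qA] Amin.
have outA o : o \in outside B -> o != Some x -> o \in outside A.
  move=> oB ox; apply: (subsetP (outsideS AB)); case: o oB ox => [v|_ _].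
    by rewrite !outsideE !inE negb_or => -> vx; rewrite andbT.
  exact: outside_None.
have aboveA b : f x <= f b -> above A b = above B b.
  move=> xb; apply/setP => c; rewrite !inE.
  have [lt_bc|_] := ltnP (f b) (f c); last by rewrite !andbF.
  have lt_xc := leq_ltn_trans xb lt_bc.
  have cx : c != x by apply: contraTneq lt_xc => ->; rewrite ltnn.
  rewrite !andbT; apply/idP/idP => [/(subsetP AB)|cB].
    by rewrite !inE (negPf cx).
  by apply: (subsetP TA); rewrite !inE cB lt_xc !orbT.
exists A; last split=> //.
  apply/validP; split; first by apply: (subsetP TA); rewrite !inE eqxx.
  move=> b bA bs; have [bT|bT] := boolP (b \in T); last first.
    (* A bad element outside [T] could be removed, against minimality. *)
    apply: contraT => ngb; have := Amin (A :\ b).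
    rewrite (cardsD1 b A) bA ltnn => /(_ _); apply; apply/and3P; split.
    - by rewrite subsetD1 TA.
    - exact: subset_trans (subsetDl _ _) AB.
    - exact: leq_trans qA (traces_remove ngb).
  have {}bT : b = x \/ (b \in B) && (f x < f b).
    by move: bT; rewrite !inE (negPf bs) /= => /orP[/eqP|]; [left|right].
  apply/goodP; case: bT => [->{b bA bs}|/andP[bB lt_xb]].
    have uw_above : nbh u :&: above B x = nbh w :&: above B x.
      by rewrite -(setIidPr (aBB x)) !setIA uw.
    have ux : u != Some x.
      apply: contraTneq xu => ->; rewrite !inE; apply/negP => /f_mono.
      by rewrite ltnn.
    (* If [w] is [x], it is no longer outside [A]; the dummy takes its place. *)
    rewrite aboveA //; have [wx|wx] := eqVneq w (Some x); last first.
      by exists u, w; split=> //; apply: outA.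
    exists u, None; split=> //; rewrite ?outside_None ?in_set0 //; first exact: outA.
    by rewrite uw_above wx nbh_above // set0I.
  have /goodP [u' [w' [u'B w'B e bu' bw']]] := gB b bB bs.
  (* [b] ranks above [x], hence is not an in-neighbour of [x]. *)
  have u'x : u' != Some x.
    apply: contraTneq bu' => ->; rewrite !inE; apply/negP => /f_mono.
    by rewrite ltnNge (ltnW lt_xb).
  rewrite aboveA ?(ltnW lt_xb) //; have [w'x|w'x] := eqVneq w' (Some x).
    exists u', None; split=> //; rewrite ?outside_None ?in_set0 //; first exact: outA.
    by rewrite e w'x nbh_above ?(ltnW lt_xb) // set0I.
  by exists u', w'; split=> //; apply: outA.
have xa : x \notin above B x by rewrite inE ltnn andbF.
(* The elements of [B] not above [x] have rank below [f x], so together they weigh less than [x]. *)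
apply: leq_trans (_ : \sum_(b in x |: above B x) 2 ^ f b <= _).
  rewrite (big_setID (above B x)) /= (setIidPr (aBB x)) big_setU1 //= addnC.
  rewrite ltn_add2r; apply: sum_exp2_lt => // b; rewrite !inE => /andP[bx bB].
  rewrite bB -leqNgt /= in bx; rewrite ltn_neqAle bx andbT.
  by apply: contraNneq xB => /f_inj <-.
have xaA : x |: above B x \subset A by apply: subset_trans TA; apply: subsetUr.
by rewrite [leqRHS](big_setID (x |: above B x)) /= (setIidPr xaA) leq_addr.
Qed.

(** [Some s] is excluded because the source shares its empty neighbourhood with the dummy; as every
    valid set contains [s], it is never an outside object. *)
Lemma valid_separating :
  {in [set~ Some s] &, injective nbh} ->
  exists2 B, valid B &
    {in outside B &, injective (fun o => nbh o :&: B)}.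
Proof.
move=> nbh_inj.
have v1 : valid [set s].
  apply/validP; split=> [|b]; first by rewrite inE.
  by rewrite inE => ->.
(* Two nested maxima realize the lexicographic choice: trace count first, then weight. *)
case: (arg_maxnP (fun B => #|traces B B|) v1) => B0 vB0 maxB0.
pose P B := valid B && (#|traces B0 B0| <= #|traces B B|).
have PB0 : P B0 by rewrite /P vB0 leqnn.
case: (arg_maxnP (fun B => \sum_(b in B) 2 ^ f b) PB0) => B /andP[vB qB] maxB.
exists B => // u w uB wB uw; have /validP [sB _] := vB.
have no_sep u' w' y : u' \in outside B -> w' \in outside B ->
    nbh u' :&: B = nbh w' :&: B -> y \in nbh u' -> y \in nbh w'.
  move=> u'B w'B e yu; apply: contraT => yw.
  have [A vA [qA ltA]] := improve vB u'B w'B e yu yw.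
  have := maxB A; rewrite /P vA (leq_trans qB qA) => /(_ isT) leA.
  by have := leq_trans ltA leA; rewrite ltnn.
have ns o : o \in outside B -> o \in [set~ Some s].
  by rewrite !inE; apply: contraNneq => ->; rewrite mem_imset //; apply: Some_inj.
apply: nbh_inj; rewrite ?ns //; apply/setP => y.
by apply/idP/idP; apply: no_sep.
Qed.

End Traces.

(** * Deduction of the bound *)

Theorem theorem16 (V : finType) (G : digraph V) (n : nat) (order_n : #|V| = n)
  (acyclicG : acyclic G) (twin_freeG : twin_free G) :
  gammaL G <= uphalf n.
Proof.
have [s0 _|V0] := pickP (@predT V); last first.
  by apply: leq_trans (max_card _) _; rewrite -order_n (eq_card0 V0).
have [f f_inj f_mono] := acyclic_rank acyclicG.
case: (@arg_minnP _ s0 xpredT f isT) => s _ smin.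
have in_s : in_nbh G s = set0.
  apply/setP => u; rewrite !inE; apply/negP => /f_mono.
  by rewrite ltnNge smin.
have in_inj : injective (in_nbh G).
  move=> u v e; apply/eqP; apply: contraT => /twin_freeG.
  by rewrite /twins e eqxx.
have nbh_inj : {in [set~ Some s] &, injective (nbh G)}.
  move=> [u|] [v|] //=; rewrite !inE => us vs e.
  - by rewrite (in_inj u v).
  - by case/eqP: us; rewrite (in_inj u s) // in_s.
  - by case/eqP: vs; rewrite (in_inj v s) // in_s.
have [B vB sepB] := valid_separating f_inj f_mono nbh_inj.
have ldB : locating_dominating G B.
  apply/andP; split.
    apply/forall_inP => v vB'; apply: contraT => no_u.
    (* An undominated [v] would have the empty trace of the dummy. *)
    suff: Some v = None by [].
    apply: sepB; rewrite ?outsideE ?outside_None //=.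
    apply/setP => u; rewrite !inE; apply/negP => /andP[uv uB].
    by case/negP: no_u; apply/exists_inP; exists u.
  apply/forallP => u; apply/forallP => v; apply/implyP => /and3P[uB vB' uv].
  apply: contra uv => /eqP e; apply/eqP/Some_inj.
  by apply: sepB; rewrite ?outsideE.
apply: leq_trans (gammaL_min ldB) _.
have := valid_card f_inj vB; rewrite card_in_imset // => leB.
have := card_outside B; rewrite order_n => e.
(* The dummy accounts for the [+ 1] in [2 * #|B| <= n + 1], hence for the upper rounding. *)
by rewrite -(half_double #|B|) uphalfE half_leq // -addnn -e leq_add2r.
Qed.
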